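(* (Quasi-Fermat Theorem) Let $X$ be a normed vector space over $\mathbb{R}$ with norm $\|\cdot\|$, let $\Omega\subseteq X$ be open, and let $f:\Omega\to\mathbb{R}$ be specularly Gâteaux differentiable in $\Omega$ (i.e. at every point of $\Omega$). If $x^{*}\in\Omega$ is a local minimizer or a local maximizer of $f$, then for each $v\in X$ $$\left|\partial_v^{\wedge}f(x^{*})\right|\le\|v\|.$$
   Context: The norm on $X\times\mathbb{R}$ is $\|(x,y)\|_{X\times\mathbb{R}}:=(\|x\|^2+|y|^2)^{1/2}$. $X^*$ is the space of continuous linear functionals on $X$. Specular directional derivative of $f$ at $x\in\Omega$ in direction $v\in X\setminus\{0\}$: $$\partial_v^{\wedge}f(x):=\lim_{h\searrow 0}\left[\frac{f(x+hv)-f(x)}{h}\cdot\frac{\|U\|_{X\times\mathbb{R}}}{\|U\|_{X\times\mathbb{R}}+\|V\|_{X\times\mathbb{R}}}+\frac{f(x)-f(x-hv)}{h}\cdot\frac{\|V\|_{X\times\mathbb{R}}}{\|U\|_{X\times\mathbb{R}}+\|V\|_{X\times\mathbb{R}}}\right]$$ (limit over $h>0$), when it exists in $\mathbb{R}$, where $U:=(hv,f(x)-f(x-hv))$ and $V:=(hv,f(x+hv)-f(x))$ for sufficiently small $h>0$; and $\partial_0^{\wedge}f(x):=0$. $f$ is specularly Gâteaux differentiable at $x$ if $\partial_v^{\wedge}f(x)$ exists for all $v\in X$ and there is $\ell\in X^*$ with $\ell(v)=\partial_v^{\wedge}f(x)$ for all $v\in X$. *)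

(* Defs.v *)
From mathcomp Require Export all_boot all_order all_algebra.
From mathcomp Require Export all_classical all_reals all_analysis.

Set Implicit Arguments.
Unset Strict Implicit.
Unset Printing Implicit Defensive.

Export Order.TTheory GRing.Theory Num.Theory.
Export numFieldNormedType.Exports.

Local Open Scope classical_set_scope.
Local Open Scope ring_scope.

(* The library's canonical norm on X * R is the max norm, hence this explicit
   Euclidean product norm. *)
Definition prod_norm2 (R : realType) (X : normedModType R) (p : X * R) : R :=
  Num.sqrt (`|p.1| ^+ 2 + `|p.2| ^+ 2).

(* A function f : Omega -> R on an open set Omega is represented by a total
   function f : X -> R. At a point of Omega the limits h -> 0+ below see only
   the values of f on Omega. *)
Definition specular_quotient (R : realType) (X : normedModType R)
    (f : X -> R) (x v : X) (h : R) : R :=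
  let U := (h *: v, f x - f (x - h *: v)) in
  let V := (h *: v, f (x + h *: v) - f x) in
  (f (x + h *: v) - f x) / h
    * (prod_norm2 U / (prod_norm2 U + prod_norm2 V)) +
  (f x - f (x - h *: v)) / h
    * (prod_norm2 V / (prod_norm2 U + prod_norm2 V)).

Definition specular_derivable (R : realType) (X : normedModType R)
    (f : X -> R) (x v : X) : Prop :=
  v != 0 -> cvg (specular_quotient f x v h @[h --> 0^'+]).

(* Junk value of [lim] when [specular_derivable f x v] fails. *)
Definition specular_derive (R : realType) (X : normedModType R)
    (f : X -> R) (x v : X) : R :=
  if v == 0 then 0 else lim (specular_quotient f x v h @[h --> 0^'+]).

Definition specular_gateaux (R : realType) (X : normedModType R)
    (f : X -> R) (x : X) : Prop :=
  (forall v : X, specular_derivable f x v) /\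
  exists l : {linear X -> R^o},
    continuous l /\ forall v : X, l v = specular_derive f x v.

Definition local_minimizer (R : realType) (X : normedModType R)
    (Omega : set X) (f : X -> R) (x : X) : Prop :=
  Omega x /\ \forall y \near x, Omega y -> f x <= f y.

Definition local_maximizer (R : realType) (X : normedModType R)
    (Omega : set X) (f : X -> R) (x : X) : Prop :=
  Omega x /\ \forall y \near x, Omega y -> f y <= f x.

(* Main.v *)
Require Import Defs.
From mathcomp Require Import lra ring.

Local Open Scope classical_set_scope.
Local Open Scope ring_scope.

(** Fix a direction [v != 0] and a step [h > 0], let [a] and [b] be the forward
    and backward increments of [f] at [xs], and let [A] and [B] be the lengths
    of the secant vectors [V = (hv, a)] and [U = (hv, b)].  The specular
    quotient is [(a * B + b * A) / (h * (A + B))], a mean of [a / h] and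
    [b / h] in which each slope is weighted by the length of the other secant.
    At a local extremum [a] and [b] have opposite signs, so the two terms of the
    numerator compete; and the weights are such that the larger slope cannot
    win by much.  Indeed, if [b <= 0 <= a], then [a <= A], and the triangle
    inequality gives [B <= h |v| - b], whence
      [a * B + b * A <= A * (h |v| - b) + b * A = h |v| A],
    with a symmetric lower bound.  The quotient is therefore bounded by [|v|] for
    every small [h] ([norm_specular_quotient_le]), and the bound passes to the
    limit.  Geometrically, with [v] scaled to length one, the quotient is the
    slope of the bisector of the two secants, that is, the tangent of the mean of
    their inclinations; inclinations of opposite signs lie strictly within 90
    degrees of the horizontal, so their mean lies within 45 degrees of it. *)

Section ProdNorm2.
Context {R : realType} {X : normedModType R}.
Implicit Types p : X * R.

Lemma prod_norm2_ge0 p : 0 <= prod_norm2 p.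
Proof. exact: sqrtr_ge0. Qed.

Lemma prod_norm2_ge_fst p : `|p.1| <= prod_norm2 p.
Proof.
rewrite /prod_norm2 -[leLHS]ger0_norm// -[leLHS]sqrtr_sqr ler_wsqrtr//.
by rewrite lerDl sqr_ge0.
Qed.

Lemma prod_norm2_ge_snd p : `|p.2| <= prod_norm2 p.
Proof.
rewrite /prod_norm2 -[leLHS]ger0_norm// -[leLHS]sqrtr_sqr ler_wsqrtr//.
by rewrite lerDr sqr_ge0.
Qed.

Lemma prod_norm2_le_add p : prod_norm2 p <= `|p.1| + `|p.2|.
Proof.
rewrite /prod_norm2 -[leRHS]ger0_norm ?addr_ge0// -[leRHS]sqrtr_sqr ler_wsqrtr//.
have := normr_ge0 p.1; have := normr_ge0 p.2; nra.
Qed.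

End ProdNorm2.

(** The inequality behind the theorem: crossed weights [B] for [a] and [A] for
    [b] make the dominant parts of the two terms cancel.  The bound is
    symmetric under exchanging [(a, A)] and [(b, B)], so that minima and maxima
    are both instances of it. *)
Lemma norm_crossed_sum_le {R : realType} (n a b A B : R) :
  b <= 0 <= a -> 0 <= n ->
  `|a| <= A <= n + `|a| -> `|b| <= B <= n + `|b| ->
  `|a * B + b * A| <= n * (A + B).
Proof.
move=> /andP[b0 a0] n0; rewrite (ger0_norm a0) (ler0_norm b0).
move=> /andP[aA Ana] /andP[bB Bnb].
by rewrite ler_norml; apply/andP; split; nra.
Qed.

Section SpecularQuotient.
Context {R : realType} {X : normedModType R}.
Implicit Types (f : X -> R) (x v : X).

Lemma norm_specular_quotient_le f x v (h : R) : v != 0 -> 0 < h ->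
  (f x <= f (x + h *: v) /\ f x <= f (x - h *: v)) \/
  (f (x + h *: v) <= f x /\ f (x - h *: v) <= f x) ->
  `|specular_quotient f x v h| <= `|v|.
Proof.
move=> v0 h0 ext; rewrite /specular_quotient /=.
set a := f (x + h *: v) - f x; set b := f x - f (x - h *: v).
set A := prod_norm2 (h *: v, a); set B := prod_norm2 (h *: v, b).
have nE : `|h *: v| = h * `|v| by rewrite normrZ gtr0_norm.
have n_gt0 : 0 < h * `|v| by rewrite mulr_gt0// normr_gt0.
have A_bd : `|a| <= A <= h * `|v| + `|a|.
  by rewrite (prod_norm2_ge_snd (h *: v, a)) -nE (prod_norm2_le_add (h *: v, a)).
have B_bd : `|b| <= B <= h * `|v| + `|b|.
  by rewrite (prod_norm2_ge_snd (h *: v, b)) -nE (prod_norm2_le_add (h *: v, b)).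
have AB_gt0 : 0 < B + A.
  rewrite ltr_pwDl ?prod_norm2_ge0//; apply: lt_le_trans n_gt0 _.
  by rewrite -nE; exact: (prod_norm2_ge_fst (h *: v, b)).
have -> : a / h * (B / (B + A)) + b / h * (A / (B + A)) =
    (a * B + b * A) / (h * (B + A)).
  by field; rewrite !gt_eqF.
rewrite normrM normfV (gtr0_norm (mulr_gt0 h0 AB_gt0)) ler_pdivrMr ?mulr_gt0//.
rewrite mulrA (mulrC `|v|).
case: ext => -[fp fm].
  rewrite (addrC B); apply: norm_crossed_sum_le (ltW n_gt0) A_bd B_bd.
  by rewrite subr_le0 subr_ge0 fm.
rewrite addrC; apply: norm_crossed_sum_le (ltW n_gt0) B_bd A_bd.
by rewrite subr_le0 subr_ge0 fp.
Qed.

Lemma near_right_line {x} v {P : X -> Prop} : (\forall y \near x, P y) ->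
  \forall h \near (0 : R)^'+, P (x + h *: v).
Proof.
move=> Px.
have line_cvg : x + h *: v @[h --> (0 : R)^'+] --> x.
  rewrite -[X in _ --> X]addr0 -(scale0r v); apply: cvgD; first exact: cvg_cst.
  by apply: cvgZr_tmp; apply: cvg_at_right_filter; exact: cvg_id.
exact: line_cvg.
Qed.

Lemma norm_specular_derive_le f x v : specular_derivable f x v ->
  (\forall y \near x, f x <= f y) \/ (\forall y \near x, f y <= f x) ->
  `|specular_derive f x v| <= `|v|.
Proof.
rewrite /specular_derivable /specular_derive.
case: eqVneq => [_|v0 /(_ isT) cvq ext]; first by rewrite normr0.
rewrite -(lim_norm cvq); apply: limr_le; first exact: is_cvg_norm.
case: ext => ext.
- have fp := near_right_line v ext; have fm := near_right_line (- v) ext.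
  near=> h; apply: norm_specular_quotient_le => //.
  by left; split; [|rewrite -scalerN]; near: h.
- have fp := near_right_line v ext; have fm := near_right_line (- v) ext.
  near=> h; apply: norm_specular_quotient_le => //.
  by right; split; [|rewrite -scalerN]; near: h.
Unshelve. all: by end_near.
Qed.

End SpecularQuotient.

Theorem theorem4p6 (R : realType) (X : normedModType R) (Omega : set X)
    (f : X -> R) (xs : X) :
  open Omega ->
  (forall x : X, Omega x -> specular_gateaux f x) ->
  local_minimizer Omega f xs \/ local_maximizer Omega f xs ->
  forall v : X, `|specular_derive f xs v| <= `|v|.
Proof.
move=> oOmega diff ext v.
have Oxs : Omega xs by case: ext => -[].
have nearO : \forall y \near xs, Omega y by exact: open_nbhs_nbhs.
have [derivable_xs _] := diff xs Oxs.
apply: norm_specular_derive_le => //.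
case: ext => -[_ ext]; [left|right];
  by apply: filterS2 nearO ext => y Oy /(_ Oy).
Qed.
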